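(* Let $S$ be any subset of the set $\mathcal{P}$ of all partitions, and let $F_S(t,q)$, $\bar o_S(n)$, $\bar e_S(n)$ be as defined in the context. Then, as formal power series in $q$, $$F_S(i,-iq)=\sum_{n\ge 0}(-1)^{n}\bigl(\bar o_S(n)-\bar e_S(n)\bigr)q^n,$$ where $i=\sqrt{-1}$.
   Context: A partition of $n$ is a weakly decreasing finite sequence of positive integers with sum $n$; the empty sequence is the only partition of $0$. $\mathcal{P}$ is the set of all partitions. For $S\subseteq\mathcal{P}$, $S_n$ is the set of $\lambda\in S$ that are partitions of $n$. $\mathrm{op}(\lambda)$ is the number of odd parts of $\lambda$ (with multiplicity). Meander: given two compositions (or partitions) $\lambda=(\lambda_1,\dots,\lambda_r)$ and $\mu=(\mu_1,\dots,\mu_s)$ of $n$, the meander of type $\frac{\lambda}{\mu}$ is the graph on $n$ vertices placed in a row, with the following edges. Split the row into consecutive blocks of sizes $\lambda_1,\dots,\lambda_r$, and name the vertices of the $i$-th block, in order, $v_{i,1},\dots,v_{i,\lambda_i}$; for each $i$ and each $1\le j\le\lfloor\lambda_i/2\rfloor$ add a ''top'' edge joining $v_{i,j}$ and $v_{i,\lambda_i+1-j}$. Do the same with $\mu$ in place of $\lambda$ to get ''bottom'' edges. If a top edge and a bottom edge join the same two vertices, both are kept and they form a cycle (of length 2). Every connected component is a cycle or a path, an isolated vertex being counted as a path. Define $\mathrm{ind}_\mu(\lambda)=2C+P-1$, where $C$ and $P$ are the numbers of cycles and paths of the meander. Conjugated index: for $\lambda$ a partition of $n\ge1$, $\mathrm{cind}(\lambda):=\mathrm{ind}_\mu(\lambda)$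 where $\mu=1^n=(1,1,\dots,1)$ ($n$ ones). For the empty partition, $\mathrm{cind}(\emptyset):=-1$. Counting functions: $\bar e_S(n):=\#\{\lambda\in S_n: \mathrm{cind}(\lambda)\text{ is even}\}$, $\bar o_S(n):=\#\{\lambda\in S_n: \mathrm{cind}(\lambda)\text{ is odd}\}$, $f_S(k,n):=\#\{\lambda\in S_n:\mathrm{op}(\lambda)=k\}$, and $F_S(t,q):=\sum_{k,n\ge0}f_S(k,n)t^kq^n$ (for each $n$ only finitely many $k$ contribute). *)

(* Defs.v *)
From HB Require Import structures.
From mathcomp Require Import all_boot all_order all_algebra finmap.
From mathcomp Require Import boolp classical_sets cardinality reals complex.

Set Implicit Arguments.
Unset Strict Implicit.
Unset Printing Implicit Defensive.

Import Order.TTheory GRing.Theory Num.Theory.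

Definition is_part (l : seq nat) : bool :=
  sorted geq l && all (fun x => 0 < x) l.

Record intpart := IntPart { parts :> seq nat; partsP : is_part parts }.

HB.instance Definition _ := [isSub for parts].
HB.instance Definition _ := [Countable of intpart by <:].

Definition op (l : seq nat) : nat := count odd l.

(* The vertices of the row are 0, ..., n - 1. The block index i is 0-based, but
   the position j inside the block is 1-based, so that the formula for the arcs
   v_{i,j} -- v_{i,l_i+1-j} (1 <= j <= l_i/2) can be copied as it is. *)
Definition block_vertex (l : seq nat) (i j : nat) : nat :=
  sumn (take i l) + j.-1.

Definition arcs (l : seq nat) : seq (nat * nat) :=
  [seq (block_vertex l i j, block_vertex l i ((nth 0 l i).+1 - j))
     | i <- iota 0 (size l), j <- iota 1 (nth 0 l i)./2].

Section Meander.
(* l (top) and m (bottom) are meant to be compositions of the same n. *)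
Variables (n : nat) (l m : seq nat).

(* An edge is tagged with its side (true = top, false = bottom), so a top edge
   and a bottom edge with the same endpoints are different edges. *)
Definition edge : finType := (bool * ('I_n * 'I_n))%type.

Definition meander_edges : {set edge} :=
  [set e : edge |
     (val e.2.1, val e.2.2) \in arcs (if e.1 then l else m)]%SET.

Definition joins (e : edge) (x y : 'I_n) : bool :=
  (e.2 == (x, y)) || (e.2 == (y, x)).

Definition adj (x y : 'I_n) : bool :=
  [exists e in meander_edges, joins e x y].

Definition components : {set {set 'I_n}} :=
  equivalence_partition (connect adj) [set: 'I_n]%SET.

(* walk x [:: (e1, x1); ...; (ek, xk)] : each e_j is an edge of the meander
   joining x_{j-1} and x_j, where x_0 = x. *)
Fixpoint walk (x : 'I_n) (p : seq (edge * 'I_n)) : bool :=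
  if p is (e, y) :: p' then
    [&& e \in meander_edges, joins e x y & walk y p']
  else true.

Definition covers_edges (A : {set 'I_n}) (es : seq edge) : Prop :=
  forall e, e \in meander_edges ->
    (e.2.1 \in A) || (e.2.2 \in A) -> e \in es.

(* The case p = [::] is that of an isolated vertex. *)
Definition is_path_comp (A : {set 'I_n}) : Prop :=
  exists x p,
    [/\ walk x p, uniq (x :: unzip2 p), A =i x :: unzip2 p
      & covers_edges A (unzip1 p)].

Definition is_cycle_comp (A : {set 'I_n}) : Prop :=
  exists x p,
    [/\ p != [::] /\ walk x p, last x (unzip2 p) = x,
        uniq (unzip2 p) /\ uniq (unzip1 p), A =i unzip2 p
      & covers_edges A (unzip1 p)].

Definition ncycles : nat :=
  #|[set A in components | `[< is_cycle_comp A >]]%SET|.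
Definition npaths : nat :=
  #|[set A in components | `[< is_path_comp A >]]%SET|.

End Meander.

(* ind m l is the index with l on top and m at the bottom. *)
Definition ind (m l : seq nat) : int :=
  ((2 * ncycles (sumn l) l m + npaths (sumn l) l m)%N%:Z - 1)%R.

Definition cind (l : intpart) : int :=
  if parts l is [::] then (-1)%R else ind (nseq (sumn l) 1) l.

Definition evenz (z : int) : bool := (2 %| z)%Z.
Definition oddz (z : int) : bool := ~~ evenz z.

Section Counting.
Local Open Scope classical_set_scope.
Variable S : set intpart.

Definition parts_of (n : nat) : set intpart := [set l | S l /\ sumn l = n].

(* fset_set is the empty set on infinite sets; finite_parts_of below shows that
   all the sets it is applied to here are finite. *)
Definition ebar (n : nat) : nat :=
  #|` fset_set [set l | parts_of n l /\ evenz (cind l)]|%fset.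

Definition obar (n : nat) : nat :=
  #|` fset_set [set l | parts_of n l /\ oddz (cind l)]|%fset.

Definition fcount (k n : nat) : nat :=
  #|` fset_set [set l | parts_of n l /\ op l = k]|%fset.

Lemma finite_parts_of (n : nat) (Q : set intpart) :
  finite_set [set l | parts_of n l /\ Q l].
Proof.
pose e : intpart := IntPart (isT : is_part [::]).
pose f (t : n.-tuple 'I_n.+1) : intpart :=
  insubd e [seq x <- map val t | 0 < x].
apply: (@sub_finite_set _ _ (f @` setT)); last exact/finite_image/finite_finset.
move=> l [[_ ln] _]; have /andP[_ lpos] := partsP l.
have size_le : size l <= n.
  rewrite -ln; elim: (parts l) lpos => //= x s IH /andP[x0 /IH].
  by move=> h; rewrite -add1n leq_add.
have part_le x : x \in parts l -> x <= n.
  rewrite -ln; elim: (parts l) => //= y s IH; rewrite inE => /predU1P[->|/IH h].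
    exact: leq_addr.
  exact: leq_trans h (leq_addl _ _).
pose s := [seq (inord x : 'I_n.+1) | x <- parts l ++ nseq (n - size l) 0].
have ss : size s == n by rewrite size_map size_cat size_nseq subnKC.
exists (Tuple ss) => //=; apply: val_inj; rewrite /f /= val_insubd.
have -> : [seq x <- map val s | 0 < x] = l.
  rewrite -map_comp map_id_in => [|x].
    rewrite filter_cat filter_nseq cats0; exact/all_filterP.
  rewrite mem_cat => /orP[/part_le xn|/nseqP[-> _]] /=; exact: inordK.
by rewrite partsP.
Qed.

Lemma fcount_gt (k n : nat) : n < k -> fcount k n = 0.
Proof.
move=> nk; rewrite /fcount (_ : [set l | _] = set0) ?fset_set0 //.
rewrite -subset0 => l [[_ ln] lk]; have /andP[_ lpos] := partsP l.
move: nk; rewrite -ln -lk /op ltnNge => /negP; apply.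
elim: (parts l) lpos => //= x s IH /andP[x0 /IH]; apply: leq_add.
by case: odd.
Qed.

End Counting.

(* Formal power series, as sequences of coefficients. *)
Definition fps (A : Type) : Type := nat -> A.

Local Open Scope ring_scope.

(* F_S(t,q) as a power series in q with coefficients in Z[t]. The truncation at
   k <= n loses nothing, see coef_F. *)
Definition F (S : set intpart) : fps {poly int} :=
  fun n => \poly_(k < n.+1) (fcount S k n)%:Z.

Lemma coef_F (S : set intpart) (k n : nat) : (F S n)`_k = (fcount S k n)%:Z.
Proof. by rewrite coef_poly ltnS; case: leqP => // /fcount_gt ->. Qed.

(* G(a, b q), for G in Z[t][[q]]. *)
Definition fps_subst (C : comNzRingType) (G : fps {poly int}) (a b : C) : fps C :=
  fun n => (map_poly intr (G n)).[a] * b ^+ n.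

(* Main.v *)
Require Import Defs.
From mathcomp Require Import all_boot all_order all_algebra.
From mathcomp Require Import classical_sets reals complex.
From mathcomp Require Import finmap boolp cardinality zify.
Import GRing.Theory Num.Theory.
Local Open Scope ring_scope.

(* With [1^n] at the bottom there are no bottom edges, and the top edges form a
   matching, so the meander has no cycle and its paths are the pairs and the
   fixed points of the involution reversing every block. Hence
   [cind l + 1 = \sum_i uphalf l_i = (n + op l) / 2], so that
   [i ^ op l * (- i) ^ n = (-1) ^ n * i ^ (n + op l) = (-1) ^ n * (-1) ^ (cind l + 1)],
   and summing over the partitions of n in S gives the claim. *)

(** * Arcs as the involution reversing every block *)

Section BlockReversal.
Local Open Scope nat_scope.

(** Points beyond the last block are fixed, which makes this an involution of all of [nat], without
    a bound on [v]. *)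
Fixpoint block_rev (l : seq nat) (v : nat) : nat :=
  if l is x :: l' then
    if v < x then x.-1 - v else x + block_rev l' (v - x)
  else v.

Lemma block_revK l : involutive (block_rev l).
Proof.
elim: l => //= x l IH v; case: (ltnP v x) => vx.
  by rewrite ifT; lia.
by rewrite ltnNge leq_addr /= addKn IH subnKC.
Qed.

Lemma block_rev_lt l v : v < sumn l -> block_rev l v < sumn l.
Proof.
elim: l v => //= x l IH v vs; case: (ltnP v x) => vx; first by lia.
by rewrite ltn_add2l IH //; lia.
Qed.

(** [arcs] indexes into the whole of [l], while [block_rev] recurses on it; peeling off the first
    block lets one induction treat both. *)
Lemma arcs_cons x l :
  arcs (x :: l) = [seq (j.-1, x - j) | j <- iota 1 x./2]
                  ++ [seq (x + p.1, x + p.2) | p <- arcs l].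
Proof.
rewrite /arcs /=.
congr (_ ++ _).
  apply/eq_in_map => j; rewrite mem_iota /block_vertex /= => jx.
  by congr pair; lia.
rewrite map_flatten -map_comp -[in LHS](addn0 1%N) iotaDl -map_comp.
congr flatten; apply: eq_map => i /=; rewrite -map_comp.
by apply: eq_map => j /=; rewrite /block_vertex /= !addnA.
Qed.

(** Arcs list their left end first, and [j <= l_i/2] stops just before the middle of an odd block,
    so the range of [j] amounts to the strict inequality. *)
Lemma mem_arcs l a b : ((a, b) \in arcs l) = (a < b) && (b == block_rev l a).
Proof.
elim: l a b => [|x l IH] a b; first by rewrite in_nil /=; lia.
rewrite arcs_cons mem_cat /=.
have -> : ((a, b) \in [seq (j.-1, x - j) | j <- iota 1 x./2])
          = [&& a < x, a < b & b == x.-1 - a].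
  apply/mapP/and3P => [[j]|[ax ab /eqP bE]].
    by rewrite mem_iota => jx [-> ->]; split; lia.
  (* Vertices count from 0, positions in a block from 1. *)
  by exists a.+1; [rewrite mem_iota; lia|congr pair; lia].
have -> : ((a, b) \in [seq (x + p.1, x + p.2) | p <- arcs l])
          = [&& x <= a, a < b & b == x + block_rev l (a - x)].
  apply/mapP/and3P => [[[c d] + [-> ->]] /=|[xa ab /eqP bE]].
    by rewrite IH addKn => /andP[cd /eqP <-]; split; lia.
  by exists (a - x, b - x); [rewrite IH; lia|congr pair => /=; lia].
by case: (ltnP a x) => ax /=; rewrite ?orbF.
Qed.

Lemma count_block_rev l :
  count (fun v => v <= block_rev l v) (iota 0 (sumn l)) = sumn (map uphalf l).
Proof.
elim: l => //= x l IH; rewrite iotaD count_cat add0n; congr (_ + _).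
  (* In the first block, [v <= x.-1 - v] selects the left half, including the middle when [x] is
     odd. *)
  rewrite (@eq_in_count _ _ (fun v => v < uphalf x)); last first.
    by move=> v; rewrite mem_iota /= => vx; rewrite vx; lia.
  rewrite -{2}(subnKC (_ : uphalf x <= x)); last by lia.
  rewrite iotaD count_cat add0n (@eq_in_count _ _ predT); last first.
    by move=> v; rewrite mem_iota.
  rewrite count_predT size_iota (@eq_in_count _ _ pred0); last first.
    by move=> v; rewrite mem_iota /=; lia.
  by rewrite count_pred0 addn0.
rewrite -[X in iota X _]addn0 iotaDl count_map -IH; apply: eq_count => v /=.
by rewrite ltnNge leq_addr /= addKn leq_add2l.
Qed.

Lemma double_sumn_uphalf l : (sumn (map uphalf l)).*2 = sumn l + op l.
Proof. by rewrite /op; elim: l => //= x l IH; lia. Qed.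

Lemma arcs_ones n : arcs (nseq n 1) = [::].
Proof.
case E: (arcs _) => [//|[a b] s]; have := mem_head (a, b) s.
rewrite -E mem_arcs; suff -> : block_rev (nseq n 1) a = a by lia.
by elim: n a {E} => //= n IH a; rewrite IH; case: ltnP; lia.
Qed.

End BlockReversal.

(** * Components of the meander with [1^n] at the bottom *)

Section MeanderOverOnes.
Local Open Scope nat_scope.
Variable l : seq nat.
Let n := sumn l.
Let ones := nseq n 1.

Definition ord_rev (x : 'I_n) : 'I_n := Ordinal (block_rev_lt l x (ltn_ord x)).

Lemma ord_revK : involutive ord_rev.
Proof. by move=> x; apply: val_inj; rewrite /= block_revK. Qed.

Lemma mem_meander_edges (e : edge n) :
  (e \in meander_edges n l ones) =
  [&& e.1, e.2.1 < e.2.2 & e.2.2 == ord_rev e.2.1].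
Proof.
rewrite inE; case: e => -[] [a b] /=; first by rewrite mem_arcs.
by rewrite /ones arcs_ones in_nil.
Qed.

Lemma adj_ones x y : adj l ones x y = (x != y) && (y == ord_rev x).
Proof.
apply/existsP/andP => [[[b [c d]] /andP[]]|[xy /eqP yE]].
  rewrite mem_meander_edges /joins /= => /and3P[_ cd /eqP dE].
  have cNd : c != d by rewrite neq_ltn cd.
  case/orP=> /eqP[<- <-]; first by rewrite cNd dE.
  by rewrite eq_sym cNd dE ord_revK.
case: (ltngtP x y) => [lt_xy|lt_yx|/val_inj exy].
- exists (true, (x, y)).
  by rewrite mem_meander_edges /joins /= lt_xy yE !eqxx.
- exists (true, (y, x)).
  by rewrite mem_meander_edges /joins /= lt_yx yE ord_revK !eqxx orbT.
by rewrite exy eqxx in xy.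
Qed.

(** Since [ord_rev] is an involution, a path in the graph only alternates between [x] and
    [ord_rev x]. *)
Lemma connect_ones x y :
  connect (adj l ones) x y = (y == x) || (y == ord_rev x).
Proof.
apply/idP/idP; last first.
  case/predU1P=> [->|/eqP yE]; first exact: connect0.
  have [->|xy] := eqVneq x y; first exact: connect0.
  by apply: connect1; rewrite adj_ones xy yE /=.
case/connectP=> p; elim/last_ind: p y => [y _ -> /=|p z IH y].
  by rewrite eqxx.
rewrite rcons_path last_rcons adj_ones => /andP[/IH/(_ erefl) pI].
move=> /andP[_ /eqP zE] ->; rewrite zE.
by case/orP: pI => /eqP ->; rewrite ?ord_revK eqxx ?orbT.
Qed.

Definition rev_class (x : 'I_n) : {set 'I_n} := [set x; ord_rev x]%SET.

Lemma rev_class_rev x : rev_class (ord_rev x) = rev_class x.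
Proof. by rewrite /rev_class ord_revK finset.setUC. Qed.

(** Each class is represented by its smaller element, so that the components are counted by
    [count_block_rev]. *)
Lemma components_ones :
  components n l ones = (rev_class @: [set x : 'I_n | x <= ord_rev x])%SET.
Proof.
have classE x : [set y in [set: 'I_n] | connect (adj l ones) x y]%SET
                = rev_class x.
  by apply/setP=> y; rewrite !inE connect_ones.
apply/setP=> A; apply/imsetP/imsetP => -[x xI ->]; last first.
  by exists x; rewrite ?inE ?classE.
rewrite classE; have [le|lt] := leqP x (ord_rev x).
  by exists x; rewrite ?inE.
exists (ord_rev x); last by rewrite rev_class_rev.
by rewrite inE ord_revK ltnW.
Qed.

Lemma rev_class_inj : {in [set x : 'I_n | x <= ord_rev x]%SET &, injective rev_class}.
Proof.
move=> x y; rewrite !inE => xr yr xy; apply: val_inj.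
have /set2P[->//|xE] : x \in rev_class y by rewrite -xy set21.
have /set2P[->//|yE] : y \in rev_class x by rewrite xy set21.
apply/eqP; rewrite eqn_leq.
by move: xr yr; rewrite -yE -xE => -> ->.
Qed.

Lemma card_components_ones : #|components n l ones| = sumn (map uphalf l).
Proof.
rewrite components_ones card_in_imset; last exact: rev_class_inj.
rewrite -count_block_rev -val_enum_ord count_map cardsE cardE size_filter.
by rewrite -enumT.
Qed.

Lemma path_comp_ones A : A \in components n l ones -> is_path_comp l ones A.
Proof.
rewrite components_ones => /imsetP[x]; rewrite inE => xr ->.
(* A fixed point is an isolated vertex, as an edge there would be a loop; any other class is a path
   with one edge. *)
have [xE|xN] := eqVneq (ord_rev x) x.
  exists x, [::]; split=> //.
    by move=> y; rewrite !inE xE orbb.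
  move=> [b [c d]]; rewrite mem_meander_edges /= !inE xE !orbb.
  move=> /and3P[_ cd /eqP dE] /orP[]/eqP E; move: cd.
    by rewrite dE E xE ltnn.
  by rewrite -[c]ord_revK -dE E xE ltnn.
have lt : x < ord_rev x by rewrite ltn_neqAle xr eq_sym xN.
exists x, [:: ((true, (x, ord_rev x)), ord_rev x)]; split.
- by rewrite /walk mem_meander_edges /joins /= lt !eqxx.
- by rewrite /= inE eq_sym xN.
- by move=> y; rewrite !inE.
move=> [b [c d]]; rewrite mem_meander_edges /= !inE.
move=> /and3P[-> cd /eqP dE]; rewrite dE in cd *.
move=> cx; suff -> : c = x by rewrite eqxx.
case/orP: cx => [/orP[/eqP->//|/eqP cE]|/orP[/eqP cE|/eqP/(can_inj ord_revK)//]].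
  by move: cd lt; rewrite cE ord_revK /=; lia.
by move: cd lt; rewrite -cE ord_revK /=; lia.
Qed.

(** A vertex determines the other end through [ord_rev], the strict inequality determines the order
    of the ends, and the tag is always [true]. *)
Lemma meander_edges_matching (e f : edge n) x :
  e \in meander_edges n l ones -> f \in meander_edges n l ones ->
  (e.2.1 == x) || (e.2.2 == x) -> (f.2.1 == x) || (f.2.2 == x) -> e = f.
Proof.
case: e f => [b [c d]] [b' [c' d']]; rewrite !mem_meander_edges /=.
move=> /and3P[-> lt /eqP dE] /and3P[-> lt' /eqP dE'].
rewrite {}dE {}dE' in lt lt' *; move=> /orP[]/eqP E /orP[]/eqP E'.
- by rewrite E E'.
- by move: lt lt'; rewrite E -E' ord_revK /=; lia.
- by move: lt lt'; rewrite E' -E ord_revK /=; lia.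
by rewrite -(ord_revK c) -(ord_revK c') E E'.
Qed.

Lemma not_cycle_comp_ones (A : {set 'I_n}) : ~ is_cycle_comp l ones A.
Proof.
have joinsr (e : edge n) x y : joins e x y -> (e.2.1 == y) || (e.2.2 == y).
  by rewrite /joins; case: e => b [c d] /= /orP[]/eqP[-> ->]; rewrite eqxx ?orbT.
have joinsC (e : edge n) x y : joins e x y = joins e y x.
  by rewrite /joins orbC.
case=> x [[|[e y] [|[f z] p]] []] [// _] /=.
  (* A closed walk of length one would be a loop. *)
  rewrite andbT => /andP[eI eJ] yx _ _ _; move: eJ eI; rewrite yx.
  rewrite mem_meander_edges /joins orbb => /eqP -> /=.
  by rewrite ltnn andbF.
(* The first two edges of a longer walk share [y], hence coincide, against the uniqueness of the
   edges. *)
move=> /and5P[eI eJ fI fJ _] _ [_ /=]; rewrite inE negb_or.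
rewrite (meander_edges_matching e f y) ?eqxx //; first exact: joinsr eJ.
by rewrite joinsC in fJ; exact: joinsr fJ.
Qed.

Lemma ind_ones : ind ones l = ((sumn (map uphalf l))%:Z - 1)%R.
Proof.
rewrite /ind /ncycles /npaths.
have -> : [set A in components (sumn l) l ones
            | `[< is_cycle_comp l ones A >]]%SET = finset.set0.
  apply/setP=> A; rewrite !inE; apply/negP => /andP[_ /asboolP].
  exact: not_cycle_comp_ones.
have -> : [set A in components (sumn l) l ones
            | `[< is_path_comp l ones A >]]%SET
          = components (sumn l) l ones.
  apply/setP=> A; rewrite inE; apply/andb_idr => /path_comp_ones AP.
  exact/asboolP.
by rewrite cards0 muln0 add0n card_components_ones.
Qed.

End MeanderOverOnes.

(** * Parity of the index and the generating function *)

Lemma evenz_cind (l : intpart) : evenz (cind l) = odd (sumn (map uphalf l)).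
Proof.
have -> : cind l = (sumn (map uphalf l))%:Z - 1.
  (* For the empty partition the sum is 0, in agreement with the convention [cind = -1]. *)
  rewrite /cind; case: l => -[|x l] lP //=.
  by rewrite -(ind_ones (x :: l)).
by rewrite /evenz; lia.
Qed.

Lemma finite_parts (S : set intpart) n : finite_set (parts_of S n).
Proof.
apply: sub_finite_set (finite_parts_of S n setT) => l lS.
by split.
Qed.

(** Puts [fcount], [obar] and [ebar] over one common enumeration, so that both sides become sums to
    be compared term by term. *)
Lemma card_parts_of_count (S : set intpart) n (P : pred intpart) :
  (#|` fset_set [set l | parts_of S n l /\ P l]%classic|)%fset
  = count P (fset_set (parts_of S n)).
Proof.
rewrite -size_filter; apply: perm_size; apply: uniq_perm.
- exact: fset_uniq.
- by rewrite filter_uniq // fset_uniq.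
move=> l; rewrite mem_filter !in_fset_set; try exact: finite_parts_of; last exact: finite_parts.
apply/idP/andP => [/set_mem[lS lP]|[lP /set_mem lS]]; last exact/mem_set.
by split=> //; exact/mem_set.
Qed.

Lemma mem_parts_of (S : set intpart) n l :
  l \in fset_set (parts_of S n) -> sumn l = n.
Proof. by rewrite in_fset_set; [case/set_mem | exact: finite_parts]. Qed.

Lemma op_le_sumn l : (op l <= sumn l)%N.
Proof. by rewrite /op; elim: l => //= x l IH; lia. Qed.

Lemma horner_F (C : comNzRingType) (S : set intpart) n (a : C) :
  (map_poly intr (F S n)).[a] = \sum_(l <- fset_set (parts_of S n)) a ^+ op l.
Proof.
rewrite /F; have -> : map_poly intr (\poly_(k < n.+1) (fcount S k n)%:Z)
  = \poly_(k < n.+1) (fcount S k n)%:R :> {poly C}.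
  by apply/polyP => k; rewrite coef_map !coef_poly /=; case: ifP.
rewrite horner_poly.
(* Group the partitions by their number of odd parts; as [op l <= n], every one of them falls in a
   group. *)
transitivity (\sum_(k < n.+1) \sum_(l <- fset_set (parts_of S n) | op l == k) a ^+ op l).
  apply: eq_bigr => k _; rewrite (eq_bigr (fun=> a ^+ k)) => [|l /eqP->//].
  rewrite big_const_seq iter_addr_0 mulr_natl; congr (_ *+ _).
  rewrite -(card_parts_of_count S n (fun l => op l == k)) /fcount.
  by congr (#|` fset_set _|)%fset; apply/seteqP; split=> l [lS /eqP lk].
rewrite (exchange_big_dep predT) //= big_seq [RHS]big_seq.
apply: eq_bigr => l /mem_parts_of ln.
have lt : (op l < n.+1)%N by rewrite ltnS -ln op_le_sumn.
by rewrite (big_pred1 (Ordinal lt)) // => k; rewrite eq_sym.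
Qed.

(** The shift by 1 in [cind] swaps parities: an odd index means an even exponent, hence the sign
    [+1]. *)
Lemma obar_sub_ebar (C : pzRingType) (S : set intpart) n :
  (obar S n)%:R - (ebar S n)%:R
  = \sum_(l <- fset_set (parts_of S n)) (-1) ^+ sumn (map uphalf l) :> C.
Proof.
rewrite /obar /ebar (card_parts_of_count S n (fun l => oddz (cind l))).
rewrite (card_parts_of_count S n (fun l => evenz (cind l))).
elim: (enum_fset _) => [|l s IH] /=; first by rewrite big_nil subrr.
rewrite big_cons -IH /oddz evenz_cind -signr_odd.
case: odd; rewrite /= !natrD add0r; first by rewrite opprD addrCA.
by rewrite expr0 addrA.
Qed.

Lemma fps_subst_F (C : comNzRingType) (S : set intpart) (a : C) n :
  a ^+ 2 = -1 ->
  fps_subst (F S) a (- a) n = (-1) ^+ n * ((obar S n)%:R - (ebar S n)%:R).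
Proof.
move=> a2; rewrite /fps_subst horner_F obar_sub_ebar mulr_suml mulr_sumr.
rewrite big_seq [RHS]big_seq; apply: eq_bigr => l /mem_parts_of ln.
(* Once [(-1) ^+ n] is split off, the powers of [a] merge into an even exponent, twice the sum of
   the [uphalf]. *)
rewrite (exprNn a) mulrCA -(exprD a); congr (_ * _).
by rewrite addnC -ln -double_sumn_uphalf -mul2n exprM a2.
Qed.

Theorem theorem5 (R : realType) (S : set intpart) :
  fps_subst (F S) ('i%C : R[i]) (- 'i%C)
  = (fun n : nat => (-1) ^+ n * ((obar S n)%:R - (ebar S n)%:R)).
Proof. by apply/funext => n; apply: fps_subst_F; exact: sqr_i. Qed.
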